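(* Let $k$ be an algebraically closed field and let $G={\rm Spec}\,A$ be a (linearly) semisimple affine $k$-group. Then for all indices $(i,r,s)$ and $(i',r',s')$, $$T^2(\delta^i_{rs},\delta^{i'}_{r's'})=T_2(w^i_{rs}/n_i,\,w^{i'}_{r's'}/n_{i'})=\begin{cases}1/n_i & \text{if } i=i',\ r=s' \text{ and } s=r',\\ 0&\text{otherwise.}\end{cases}$$
   Context: An affine $k$-group $G={\rm Spec}\,A$ is called (linearly) semisimple if every linear representation of $G$ is completely reducible. $A^*={\rm Hom}_k(A,k)$ is a $k$-algebra with the product dual to the comultiplication of $A$. Let $\hat G$ be the set of irreducible linear representations $\rho_i\colon G\to{\rm End}_k(E_i)$ (up to isomorphism), $n_i=\dim_k E_i$. Then $A^*=\prod_{\rho_i\in\hat G}{\rm End}_k(E_i)$, $A=\bigoplus_i{\rm End}_k(E_i)^*$, and $\tilde A:=\bigoplus_i{\rm End}_k(E_i)\subseteq A^*$. The invariant integral $w_G\in A^*$ is the unique $G$-invariant linear form on $A$ with $w_G(1)=1$; the map $a\mapsto a^*$ on $A$ is induced by $g\mapsto g^{-1}$; and $T^2(a,a'):=w_G(a^*\cdot a')$ for $a,a'\in A$. On $\tilde A$, $T_2(b,b')=tr(bb')$ where $tr(b)=\sum_i(\text{trace of the endomorphism } b'\mapsto b_ib' \text{ of } {\rm End}_k(E_i))$. Fixing bases, identify ${\rm End}_k(E_i)=M_{n_i}(k)$; $w^i_{rs}\in M_{n_i}(k)\subseteq\tilde A$ is the matrix with $rs$-coefficient $1$ and all others $0$;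 $\{\delta^i_{rs}\}_{i,r,s}\subset A$ is the dual basis of $\{w^i_{rs}\}_{i,r,s}$. Equivalently, $\delta^i_{rs}(g)=g^i_{rs}$, the $rs$-coefficient of the matrix $\rho_i(g)$, for $g\in G$. The integers $n_i$ are invertible in $k$. *)

(* Defs.v *)
From HB Require Import structures.
From mathcomp Require Import all_boot all_algebra.
From mathcomp Require Import boolp classical_sets cardinality fsbigop.

Set Implicit Arguments.
Unset Strict Implicit.
Unset Printing Implicit Defensive.

Import GRing.Theory.
Local Open Scope quotient_scope.
Local Open Scope classical_set_scope.
Local Open Scope ring_scope.

Notation is_bilinear f := (bilinear_for *:%R *:%R f).

(* The tensor product of two k-modules: a list of pairs stands for the sum of  *)
(* the corresponding pure tensors, and two lists are identified when every     *)
(* bilinear map sends them to the same value.                                  *)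
Section Tensor.
Context {k : comNzRingType}.

Section TensorModule.
Variables U V : lmodType k.

Definition bsum (W : lmodType k) (f : U -> V -> W) (s : seq (U * V)) : W :=
  \sum_(p <- s) f p.1 p.2.

Definition tens_eq : rel (seq (U * V)) := fun s t =>
  `[< forall (W : lmodType k) (f : U -> V -> W), is_bilinear f ->
        bsum f s = bsum f t >].

Lemma tens_eq_refl : reflexive tens_eq. Proof. by move=> s; apply/asboolP. Qed.

Lemma tens_eq_sym : symmetric tens_eq.
Proof.
by move=> s t; apply/asboolP/asboolP => h W f bf; rewrite h.
Qed.

Lemma tens_eq_trans : transitive tens_eq.
Proof.
move=> t s u /asboolP h /asboolP h'; apply/asboolP => W f bf.
by rewrite h // h'.
Qed.

Canonical tens_equiv := EquivRel tens_eq tens_eq_refl tens_eq_sym tens_eq_trans.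

Definition tens := {eq_quot tens_equiv}.

HB.instance Definition _ := Choice.on tens.

Definition tpure (u : U) (v : V) : tens := \pi_tens [:: (u, v)].

(* The linear map on U (x) V induced by f; meaningful for bilinear f. *)
Definition tlift (W : lmodType k) (f : U -> V -> W) (x : tens) : W :=
  bsum f (repr x).

Lemma tensP (s t : seq (U * V)) :
  (forall (W : lmodType k) (f : U -> V -> W), is_bilinear f ->
     bsum f s = bsum f t) -> \pi_tens s = \pi_tens t.
Proof. by move=> h; apply/eqmodP/asboolP. Qed.

Lemma tlift_pi (W : lmodType k) (f : U -> V -> W) (s : seq (U * V)) :
  is_bilinear f -> tlift f (\pi_tens s) = bsum f s.
Proof.
move=> bf; rewrite /tlift.
by have /eqmodP/asboolP := reprK (\pi_tens s : tens); apply.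
Qed.

Definition tens_zero : tens := \pi_tens [::].
Definition tens_add (x y : tens) : tens := \pi_tens (repr x ++ repr y).
Definition tens_scale (a : k) (x : tens) : tens :=
  \pi_tens [seq (a *: p.1, p.2) | p <- repr x].
Definition tens_opp (x : tens) : tens := tens_scale (-1) x.

Lemma bsum_scale (W : lmodType k) (f : U -> V -> W) a s : is_bilinear f ->
  bsum f [seq (a *: p.1, p.2) | p <- s] = a *: bsum f s.
Proof.
case=> bl br; rewrite /bsum big_map scaler_sumr; apply: eq_bigr => p _ /=.
by rewrite (scalable_linear (bl p.2)).
Qed.

Lemma bsum_cat (W : lmodType k) (f : U -> V -> W) s t :
  bsum f (s ++ t) = bsum f s + bsum f t.
Proof. exact: big_cat. Qed.

Lemma tens_ext (x y : tens) :
  (forall (W : lmodType k) (f : U -> V -> W), is_bilinear f ->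
     tlift f x = tlift f y) -> x = y.
Proof.
by move=> h; rewrite -[x]reprK -[y]reprK; apply: tensP => W f bf; exact: h.
Qed.

Lemma tlift_add (W : lmodType k) (f : U -> V -> W) x y : is_bilinear f ->
  tlift f (tens_add x y) = tlift f x + tlift f y.
Proof. by move=> bf; rewrite tlift_pi // bsum_cat. Qed.

Lemma tlift_scale (W : lmodType k) (f : U -> V -> W) a x : is_bilinear f ->
  tlift f (tens_scale a x) = a *: tlift f x.
Proof. by move=> bf; rewrite tlift_pi // bsum_scale. Qed.

Lemma tlift_zero (W : lmodType k) (f : U -> V -> W) : is_bilinear f -> tlift f tens_zero = 0.
Proof. by move=> bf; rewrite tlift_pi // /bsum big_nil. Qed.

Lemma tens_addA : associative tens_add.
Proof. by move=> x y z; apply: tens_ext => W f bf; rewrite !tlift_add // addrA. Qed.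

Lemma tens_addC : commutative tens_add.
Proof. by move=> x y; apply: tens_ext => W f bf; rewrite !tlift_add // addrC. Qed.

Lemma tens_add0 : left_id tens_zero tens_add.
Proof.
by move=> x; apply: tens_ext => W f bf; rewrite tlift_add // tlift_zero // add0r.
Qed.

Lemma tens_addN : left_inverse tens_zero tens_opp tens_add.
Proof.
move=> x; apply: tens_ext => W f bf.
by rewrite tlift_add // tlift_scale // tlift_zero // scaleN1r addNr.
Qed.

HB.instance Definition _ :=
  GRing.isZmodule.Build tens tens_addA tens_addC tens_add0 tens_addN.

Lemma tens_scaleA a b x : tens_scale a (tens_scale b x) = tens_scale (a * b) x.
Proof. by apply: tens_ext => W f bf; rewrite !tlift_scale // scalerA. Qed.

Lemma tens_scale1 : left_id 1 tens_scale.
Proof. by move=> x; apply: tens_ext => W f bf; rewrite tlift_scale // scale1r. Qed.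

Lemma tens_scaleDr : right_distributive tens_scale +%R.
Proof.
move=> a x y; apply: tens_ext => W f bf.
by rewrite tlift_scale // !tlift_add // !tlift_scale // scalerDr.
Qed.

Lemma tens_scaleDl x : {morph tens_scale^~ x : a b / a + b}.
Proof.
move=> a b; apply: tens_ext => W f bf.
by rewrite tlift_add // !tlift_scale // scalerDl.
Qed.

HB.instance Definition _ := GRing.Zmodule_isLmodule.Build k tens
  tens_scaleA tens_scale1 tens_scaleDr tens_scaleDl.

Lemma tlift_linear (W : lmodType k) (f : U -> V -> W) : is_bilinear f -> linear (tlift f).
Proof. by move=> bf a x y; rewrite tlift_add // tlift_scale. Qed.

Lemma tlift_pure (W : lmodType k) (f : U -> V -> W) u v : is_bilinear f ->
  tlift f (tpure u v) = f u v.
Proof. by move=> bf; rewrite tlift_pi // /bsum big_seq1. Qed.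

Lemma tpure_bilinear : is_bilinear tpure.
Proof.
split=> [v|u] a x y; apply: tens_ext => W f bf /=;
  rewrite tlift_add // tlift_scale // !tlift_pure //.
- exact: (bf.1 v a x y).
- exact: (bf.2 u a x y).
Qed.

Lemma tpure_sum (s : seq (U * V)) : \pi_tens s = bsum tpure s.
Proof.
apply: tens_ext => W f bf; rewrite tlift_pi // /bsum.
elim: s => [|p s IH]; first by rewrite !big_nil tlift_zero.
by rewrite !big_cons tlift_add // tlift_pure // IH.
Qed.

Lemma tens_sum (x : tens) : x = bsum tpure (repr x).
Proof. by rewrite -tpure_sum reprK. Qed.

Lemma tlift_unique (W : lmodType k) (g h : {linear tens -> W}) :
  (forall u v, g (tpure u v) = h (tpure u v)) -> g =1 h.
Proof.
move=> gh x; rewrite (tens_sum x) /bsum !linear_sum; apply: eq_bigr => p _.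
exact: gh.
Qed.

End TensorModule.

Section TensorRing.
Variables A B : comAlgType k.
Local Notation AB := (tens A B).

Definition tens_one : AB := tpure 1 1.

(* (a (x) b) (c (x) d) = ac (x) bd *)
Definition tens_mul (x y : AB) : AB :=
  tlift (fun a b => tlift (fun c d => tpure (a * c) (b * d)) y) x.

Lemma tens_mul_in (a : A) (b : B) :
  is_bilinear (fun c d => tpure (a * c) (b * d) : AB).
Proof.
have [bl br] := @tpure_bilinear A B.
split=> [v|u] z x y /=; rewrite mulrDr -scalerAr; [exact: bl|exact: br].
Qed.

Lemma tens_mul_out (y : AB) :
  is_bilinear (fun a b => tlift (fun c d => tpure (a * c) (b * d)) y : AB).
Proof.
have [bl br] := @tpure_bilinear A B.
split=> [v|u] z x x' /=; rewrite /tlift /bsum scaler_sumr -big_split;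
  apply: eq_bigr => p _ /=; rewrite mulrDl -scalerAl; [exact: bl|exact: br].
Qed.

Lemma tens_mul_pure a b c d :
  tens_mul (tpure a b) (tpure c d) = tpure (a * c) (b * d).
Proof.
by rewrite /tens_mul (tlift_pure _ _ (tens_mul_out _)) (tlift_pure _ _ (tens_mul_in a b)).
Qed.

Lemma tens_mulDl : left_distributive tens_mul +%R.
Proof. by move=> x y z; exact: (tlift_add _ _ (tens_mul_out _)). Qed.

Lemma tens_mulC : commutative tens_mul.
Proof.
move=> x y; rewrite /tens_mul /tlift /bsum exchange_big.
by apply: eq_bigr => p _; apply: eq_bigr => q _; rewrite mulrC [q.2 * _]mulrC.
Qed.

Lemma tens_mulDr : right_distributive tens_mul +%R.
Proof. by move=> x y z; rewrite tens_mulC tens_mulDl !(tens_mulC _ x). Qed.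

Lemma tens_mulr0 x : tens_mul x 0 = 0.
Proof. by rewrite tens_mulC; exact: (tlift_zero (tens_mul_out _)). Qed.

Lemma tens_mul0 x : tens_mul 0 x = 0.
Proof. exact: (tlift_zero (tens_mul_out _)). Qed.

Lemma tens_ind (P : AB -> Prop) :
  P 0 -> (forall x y, P x -> P y -> P (x + y)) ->
  (forall a b, P (tpure a b)) -> forall x, P x.
Proof.
move=> P0 PD Pp x; rewrite (tens_sum x) /bsum.
by elim/big_rec: _ => // p y _ Py; apply: PD.
Qed.

Lemma tens_mulA : associative tens_mul.
Proof.
move=> x y z; elim/tens_ind: x => [|x x' Hx Hx'|a b].
- by rewrite !tens_mul0.
- by rewrite !tens_mulDl Hx Hx'.
elim/tens_ind: y => [|y y' Hy Hy'|c d].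
- by rewrite tens_mul0 !tens_mulr0 tens_mul0.
- by rewrite tens_mulDl !tens_mulDr tens_mulDl Hy Hy'.
elim/tens_ind: z => [|z z' Hz Hz'|e f].
- by rewrite !tens_mulr0.
- by rewrite !tens_mulDr Hz Hz'.
by rewrite !tens_mul_pure !mulrA.
Qed.

Lemma tens_mul1 : left_id tens_one tens_mul.
Proof.
elim/tens_ind=> [|x y Hx Hy|a b].
- exact: tens_mulr0.
- by rewrite tens_mulDr Hx Hy.
by rewrite tens_mul_pure !mul1r.
Qed.

HB.instance Definition _ := GRing.Zmodule_isComPzRing.Build AB
  tens_mulA tens_mulC tens_mul1 tens_mulDl.

End TensorRing.

End Tensor.

Notation "u *t v" := (tpure u v) (at level 40, v at level 39, left associativity).

Section AffineGroup.
Context {k : closedFieldType}.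

(* The group structures on Spec A, i.e. the commutative Hopf algebra           *)
(* structures on A. Each tlift below is a formula in Sweedler notation: for    *)
(* instance, with comul x = \sum a (x) b, the term                             *)
(* tlift (fun a b => antipode a * b) (comul x) is \sum antipode a * b.         *)
Record affine_group (A : comAlgType k) := AffineGroup {
  comul : {lrmorphism A -> tens A A};
  counit : {lrmorphism A -> k | *%R};
  antipode : {lrmorphism A -> A};
  comulA : forall x,
    tlift (fun a b => tlift (fun c d => c *t (d *t b)) (comul a)) (comul x)
    = tlift (fun a b => a *t comul b) (comul x);
  counitl : forall x, tlift (fun a b => counit a *: b) (comul x) = x;
  counitr : forall x, tlift (fun a b => counit b *: a) (comul x) = x;
  antipodel : forall x, tlift (fun a b => antipode a * b) (comul x) = counit x *: 1;
  antipoder : forall x, tlift (fun a b => a * antipode b) (comul x) = counit x *: 1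
}.

Variables (A : comAlgType k) (G : affine_group A).

(* A linear representation of G on E, given by its value                       *)
(* e |-> g . e in E (x) A at the universal point g = id_A of G(A); the point   *)
(* g : A -> R of G then acts on E (x) R by e |-> (id (x) g) (coact e).         *)
Record linrep (E : lmodType k) := Linrep {
  coact : {linear E -> tens E A};
  coactA : forall x,
    tlift (fun e a => tlift (fun e' b => e' *t (b *t a)) (coact e)) (coact x)
    = tlift (fun e a => e *t comul G a) (coact x);
  coact1 : forall x, tlift (fun e a => counit G a *: e) (coact x) = x
}.

Definition subspace (E : lmodType k) (P : set E) : Prop :=
  P 0 /\ forall a x y, P x -> P y -> P (a *: x + y).

(* A subspace P with coact P contained in the image of P (x) A. *)
Definition subrep (E : lmodType k) (rho : linrep E) (P : set E) : Prop :=
  subspace P /\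
  forall x, P x -> exists s : seq (E * A),
    (forall p, p \in s -> P p.1) /\ coact rho x = \sum_(p <- s) p.1 *t p.2.

Definition irreducible_sub (E : lmodType k) (rho : linrep E) (P : set E) : Prop :=
  [/\ subrep rho P, P <> [set 0] &
      forall Q, subrep rho Q -> Q `<=` P -> Q = [set 0] \/ Q = P].

Definition irreducible (E : lmodType k) (rho : linrep E) : Prop :=
  irreducible_sub rho [set: E].

(* E is the direct sum of a (possibly infinite) family of irreducible          *)
(* subrepresentations.                                                         *)
Definition completely_reducible (E : lmodType k) (rho : linrep E) : Prop :=
  exists (J : choiceType) (P : J -> set E),
    (forall j, irreducible_sub rho (P j)) /\
    forall x : E, exists! f : J -> E,
      [/\ forall j, P j (f j), finite_set [set j | f j != 0] &
          x = \sum_(j \in [set: J]) f j].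

Definition semisimple : Prop :=
  forall (E : lmodType k) (rho : linrep E), completely_reducible rho.

Definition rep_iso (E F : lmodType k) (rho : linrep E) (sigma : linrep F) : Prop :=
  exists2 phi : {linear E -> F}, bijective phi &
    forall x, coact sigma (phi x) = tlift (fun e a => phi e *t a) (coact rho x).

(* The family (rho i) consists of exactly one representative of each           *)
(* isomorphism class of irreducible representations. Such representations      *)
(* are finite dimensional, whence the vectType.                                *)
Record irreps (I : choiceType) (E : I -> vectType k)
    (rho : forall i, linrep (E i)) : Prop := Irreps {
  irreps_irr : forall i, irreducible (rho i);
  irreps_inj : forall i j, rep_iso (rho i) (rho j) -> i = j;
  irreps_surj : forall (F : lmodType k) (sigma : linrep F),
    irreducible sigma -> exists i, rep_iso (rho i) sigma
}.

(* The coefficients of the matrix of a representation in the basis e:          *)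
(* coact e_s = \sum_r e_r (x) (mxcoef r s).                                    *)
Definition mxcoef (E : vectType k) (rho : linrep E) (n : nat) (e : n.-tuple E)
    (r s : 'I_n) : A :=
  tlift (fun x a => coord e r x *: a) (coact rho e`_s).

(* The action on E of a linear form on A, which extends the action of the      *)
(* points of G, and its matrix.                                                *)
Definition dual_act (E : lmodType k) (rho : linrep E) (w : {scalar A}) (x : E) : E :=
  tlift (fun e a => w a *: e) (coact rho x).

Definition dual_mx (E : vectType k) (rho : linrep E) (n : nat) (e : n.-tuple E)
    (w : {scalar A}) : 'M[k]_n :=
  \matrix_(r, s) coord e r (dual_act rho w e`_s).

(* Hence the matrix coefficients are dual to the matrix units of the           *)
(* endomorphism algebras in the dual algebra of A.                             *)
Lemma mxcoef_dual (E : vectType k) (rho : linrep E) (n : nat) (e : n.-tuple E)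
    (w : {scalar A}) (r s : 'I_n) :
  w (mxcoef rho e r s) = dual_mx rho e w r s.
Proof.
rewrite mxE /mxcoef /dual_act /tlift /bsum !linear_sum; apply: eq_bigr => p _ /=.
by rewrite !linearZ /= mulrC.
Qed.

(* Invariance under left translations: (id (x) w) o comul = w(_) 1. *)
Definition invariant_integral (w : {scalar A}) : Prop :=
  (forall x, tlift (fun a b => w b *: a) (comul G x) = w x *: 1) /\ w 1 = 1.

Definition Tup2 (w : {scalar A}) (a a' : A) : k := w (antipode G a * a').

End AffineGroup.

(* Finitely supported families of matrices: the direct sum of the matrix       *)
(* algebras M_(n i)(k), inside their product, which is the dual of A.          *)
Section MatrixSum.
Context (k : closedFieldType) {I : choiceType} (n : I -> nat).

Record mxsum := MxSum {
  mxsum_fun :> forall i, 'M[k]_(n i);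
  mxsum_fin : finite_set [set i | mxsum_fun i != 0]
}.

Lemma mxsum_mul_fin (b b' : mxsum) : finite_set [set i | b i *m b' i != 0].
Proof.
apply: sub_finite_set (mxsum_fin b) => i /=; apply: contra_neq => ->.
by rewrite mul0mx.
Qed.

Definition mxsum_mul (b b' : mxsum) : mxsum := MxSum (mxsum_mul_fin b b').

Lemma mxsum_scale_fin (c : k) (b : mxsum) : finite_set [set i | c *: b i != 0].
Proof.
apply: sub_finite_set (mxsum_fin b) => i /=; apply: contra_neq => ->.
by rewrite scaler0.
Qed.

Definition mxsum_scale (c : k) (b : mxsum) : mxsum := MxSum (mxsum_scale_fin c b).

Definition munit_fun (i : I) (r s : 'I_(n i)) : forall j, 'M[k]_(n j) :=
  @dfwith I (fun j => 'M[k]_(n j)) (fun j => 0) i (delta_mx r s).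

Lemma munit_fin (i : I) (r s : 'I_(n i)) :
  finite_set [set j | munit_fun r s j != 0].
Proof.
apply: sub_finite_set (finite_set1 i) => j /=; rewrite /munit_fun.
by case: dfwithP => // l _; rewrite eqxx.
Qed.

Definition munit (i : I) (r s : 'I_(n i)) : mxsum := MxSum (munit_fin r s).

(* lin_mulmx B is the matrix of the endomorphism X |-> B *m X of M_(n i)(k). *)
Definition mxsum_tr (b : mxsum) : k :=
  \sum_(i \in [set: I]) \tr (lin_mulmx (b i) : 'M[k]_(n i * n i)).

Definition Tdown2 (b b' : mxsum) : k := mxsum_tr (mxsum_mul b b').

End MatrixSum.

(* Main.v *)
Require Import Defs.
From HB Require Import structures.
From mathcomp Require Import all_boot all_algebra.
From mathcomp Require Import boolp classical_sets cardinality fsbigop.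

Set Implicit Arguments.
Unset Strict Implicit.
Unset Printing Implicit Defensive.

Import GRing.Theory.
Local Open Scope ring_scope.

(** Write [D] and [D'] for the matrices of coefficients of two irreducible
representations on [E] and [F], and [S] for the antipode. On points of the
group the form [Tup2] evaluates to the integral over [g] of
[D(g^-1)_rs * D'(g)_r's']. For fixed [r] and [s'] this is the [(r', s)] entry of
the average over [g] of [D'(g) B D(g)^-1], where [B : E -> F] is the matrix
unit of index [(s', r)]. The average commutes with the group because the
integral is invariant ([averaged_intertwines]), so Schur's lemma applies
([schur_bijective], [schur_scalar]): it vanishes when the representations are
not isomorphic, and when they are equal it is a scalar [c].

The scalar is found by taking the trace: [S(D) D = 1] gives
[sum_t S(D_rt) D_ts' = (r == s')], and integrating yields
[n c = (r == s')] ([orthogonal_iso]). The choice [s' = r] shows that [n] is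
invertible in [k], so [c] is [1/n] or [0].

The other side is a computation with matrix units, resting on the fact that left
multiplication by [B] on n x n matrices has trace [n tr B]
([mxtrace_lin_mulmx]).

The group being given by its coordinate ring, an identity between functions of
several group elements becomes one between elements of tensor powers of [A];
the one that needs an argument is the behaviour of the comultiplication on
[S(D)] ([comul_antipode_coefmx]). *)

(** * Linear maps out of tensor products *)

HB.instance Definition _ (k : comNzRingType) (U V : lmodType k) :=
  bilinear_isBilinear.Build k U V (tens U V) *:%R *:%R (@tpure k U V)
    (tpure_bilinear U V).

Section TensorMaps.
Variables (k : comNzRingType) (U V W X : lmodType k).

Lemma linear_tlift (g : W -> X) (f : U -> V -> W) (z : tens U V) :
  linear g -> g (tlift f z) = tlift (fun u v => g (f u v)) z.
Proof.
move=> lg; rewrite /tlift /bsum; apply: big_morph => [x y|].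
  by have := lg 1 x y; rewrite !scale1r.
by have := lg (-1) 0 0; rewrite scaler0 addr0 scaleN1r addNr.
Qed.

Lemma eq_tlift (f g : U -> V -> W) (z : tens U V) :
  (forall u v, f u v = g u v) -> tlift f z = tlift g z.
Proof. by move=> fg; apply: eq_bigr => p _; exact: fg. Qed.

Lemma tlift_sum_pure (f : U -> V -> W) (J : finType) (u : J -> U) (v : J -> V) :
  is_bilinear f -> tlift f (\sum_j u j *t v j) = \sum_j f (u j) (v j).
Proof.
move=> bf.
rewrite (big_morph (tlift f) (fun x y => tlift_add x y bf) (tlift_zero bf)).
by apply: eq_bigr => j _; rewrite tlift_pure.
Qed.

Lemma tlift_tpure (z : tens U V) : tlift (@tpure k U V) z = z.
Proof. by rewrite {2}(tens_sum z). Qed.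

Lemma bilinear_scale_fst (l : {scalar U}) :
  is_bilinear (fun (u : U) (v : V) => l u *: v).
Proof.
split=> [v|u] a x y /=; first by rewrite linearP scalerDl scalerA.
by rewrite scalerDr !scalerA mulrC.
Qed.

Lemma bilinear_scale_snd (l : {scalar V}) :
  is_bilinear (fun (u : U) (v : V) => l v *: u).
Proof.
split=> [v|u] a x y /=; last by rewrite linearP scalerDl scalerA.
by rewrite scalerDr !scalerA mulrC.
Qed.

Lemma bilinear_tpure_fst (f : U -> W) :
  linear f -> is_bilinear (fun (u : U) (v : V) => f u *t v).
Proof.
move=> lf; split=> [v|u] a x y /=; last by rewrite linearDr linearZr_LR.
by rewrite lf linearDl linearZl_LR.
Qed.

End TensorMaps.

Lemma bilinear_mul (k : comNzRingType) (A : comAlgType k)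
    (f g : {linear A -> A}) : is_bilinear (fun a b : A => f a * g b).
Proof.
split=> [v|u] a x y /=; first by rewrite linearP mulrDl scalerAl.
by rewrite linearP mulrDr scalerAr.
Qed.

(** * The two embeddings of an algebra in its tensor square *)

Section TensorEmbeddings.
Variables (k : comNzRingType) (A : comAlgType k).

Definition tens_inl (a : A) : tens A A := a *t 1.
Definition tens_inr (a : A) : tens A A := 1 *t a.

Lemma tens_inl_zmod : zmod_morphism tens_inl.
Proof. by move=> a b; rewrite /tens_inl linearBl. Qed.

Lemma tens_inr_zmod : zmod_morphism tens_inr.
Proof. by move=> a b; rewrite /tens_inr linearBr. Qed.

Lemma tpure_mul (a b c d : A) : (a *t b) * (c *t d) = (a * c) *t (b * d).
Proof. exact: tens_mul_pure. Qed.

Lemma tens_inl_monoid : monoid_morphism tens_inl.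
Proof. by split=> // a b; rewrite tpure_mul mulr1. Qed.

Lemma tens_inr_monoid : monoid_morphism tens_inr.
Proof. by split=> // a b; rewrite tpure_mul mulr1. Qed.

HB.instance Definition _ :=
  GRing.isZmodMorphism.Build A (tens A A) tens_inl tens_inl_zmod.
HB.instance Definition _ :=
  GRing.isMonoidMorphism.Build A (tens A A) tens_inl tens_inl_monoid.
HB.instance Definition _ :=
  GRing.isZmodMorphism.Build A (tens A A) tens_inr tens_inr_zmod.
HB.instance Definition _ :=
  GRing.isMonoidMorphism.Build A (tens A A) tens_inr tens_inr_monoid.

End TensorEmbeddings.

(** * Matrix coefficients and the Hopf algebra structure *)

Section Coefficients.
Variables (k : closedFieldType) (A : comAlgType k) (G : affine_group A).
Variables (E : vectType k) (rho : linrep G E) (n : nat) (e : n.-tuple E).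
Hypothesis e_basis : basis_of fullv e.

Definition coefmx : 'M[A]_n := \matrix_(r, s) mxcoef rho e r s.

Lemma basis_sum (x : E) : x = \sum_(r < n) coord e r x *: e`_r.
Proof. by rewrite -(coord_basis e_basis) ?memvf. Qed.

Lemma coact_basis (s : 'I_n) : coact rho e`_s = \sum_(r < n) e`_r *t coefmx r s.
Proof.
rewrite [LHS]tens_sum /bsum.
under [RHS]eq_bigr => r _ do rewrite mxE /mxcoef /tlift /bsum linear_sumr.
rewrite exchange_big; apply: eq_bigr => p _ /=.
rewrite [X in X *t _]basis_sum linear_sumlz; apply: eq_bigr => r _.
by rewrite linearZl_LR linearZr_LR.
Qed.

Lemma tlift_coact_basis (W : lmodType k) (f : E -> A -> W) (s : 'I_n) :
  is_bilinear f -> tlift f (coact rho e`_s) = \sum_(r < n) f e`_r (coefmx r s).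
Proof. by move=> bf; rewrite coact_basis tlift_sum_pure. Qed.

(** Coassociativity of the coaction at [e`_s], read off in the coordinate [r]:
the rule [D(gh) = D(g) D(h)]. *)
Lemma comul_coefmx (r s : 'I_n) :
  comul G (coefmx r s) = \sum_(t < n) coefmx r t *t coefmx t s.
Proof.
pose c x : A := tlift (fun y a => coord e r y *: a) (coact rho x).
have lc : linear c.
  move=> a x y; rewrite /c linearP.
  exact: (tlift_linear (bilinear_scale_fst A (coord e r))).
pose g (x : E) (z : tens A A) : tens A A := coord e r x *: z.
have bg : is_bilinear g by exact: bilinear_scale_fst.
have lg := tlift_linear bg.
(* [c x] is the coefficient of [coact x] along [e`_r], and [tlift g] takes that
   coefficient in the first tensor factor. *)
have := congr1 (tlift g) (coactA rho e`_s).
rewrite !(linear_tlift _ _ lg) => LR.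
have -> : comul G (coefmx r s) =
    tlift (fun x a => tlift g (x *t comul G a)) (coact rho e`_s).
  rewrite mxE /mxcoef linear_tlift; last exact: linearP.
  by apply: eq_tlift => x a; rewrite linearZ tlift_pure.
rewrite -LR.
have -> : tlift (fun x a =>
      tlift g (tlift (fun y b => y *t (b *t a)) (coact rho x))) (coact rho e`_s)
    = tlift (fun x a => c x *t a) (coact rho e`_s).
  apply: eq_tlift => x a; rewrite (linear_tlift _ _ lg) /c.
  rewrite (linear_tlift _ _ ((tpure_bilinear A A).1 a)).
  by apply: eq_tlift => y b; rewrite tlift_pure // linearZl_LR.
rewrite tlift_coact_basis; last exact: bilinear_tpure_fst.
by apply: eq_bigr => t _; rewrite [coefmx r t]mxE.
Qed.

Lemma counit_coefmx (r s : 'I_n) : counit G (coefmx r s) = (r == s)%:R.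
Proof.
have := mxcoef_dual rho e (counit G : {scalar A}) r s.
rewrite !mxE /= => ->; rewrite /dual_act coact1 coord_free ?(basis_free e_basis) //.
by rewrite eq_sym.
Qed.

Lemma antipode_coefmxl : map_mx (antipode G) coefmx *m coefmx = 1%:M.
Proof.
apply/matrixP => r s; rewrite [RHS]mxE.
have := antipodel G (coefmx r s).
rewrite comul_coefmx tlift_sum_pure; last exact: (bilinear_mul (antipode G) idfun).
rewrite counit_coefmx scaler_nat => <-.
by rewrite mxE; apply: eq_bigr => t _; rewrite !mxE.
Qed.

Lemma antipode_coefmxr : coefmx *m map_mx (antipode G) coefmx = 1%:M.
Proof.
apply/matrixP => r s; rewrite [RHS]mxE.
have := antipoder G (coefmx r s).
rewrite comul_coefmx tlift_sum_pure; last exact: (bilinear_mul idfun (antipode G)).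
rewrite counit_coefmx scaler_nat => <-.
by rewrite mxE; apply: eq_bigr => t _; rewrite !mxE.
Qed.

(** The rule [D((gh)^-1) = D(h)^-1 D(g)^-1]. Over the ring [A (x) A], both sides
are inverse to the matrix [comul D]: the left one because [comul] is a ring
morphism, the right one because [comul D] is the product of the images of [D]
under the two embeddings. Inverses being unique, they agree. *)
Lemma comul_antipode_coefmx (r s : 'I_n) :
  comul G (antipode G (coefmx r s)) =
  \sum_(t < n) antipode G (coefmx t s) *t antipode G (coefmx r t).
Proof.
set S := map_mx (antipode G) coefmx.
pose X := map_mx (comul G) S; pose Y := map_mx (comul G) coefmx.
pose Z := map_mx (@tens_inr k A) S *m map_mx (@tens_inl k A) S.
have XY : X *m Y = 1%:M by rewrite /X /Y -map_mxM antipode_coefmxl map_mx1.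
have YE : Y = map_mx (@tens_inl k A) coefmx *m map_mx (@tens_inr k A) coefmx.
  apply/matrixP => i j; rewrite [LHS]mxE [RHS]mxE comul_coefmx.
  apply: eq_bigr => t _.
  by rewrite [X in _ = X * _]mxE [X in _ = _ * X]mxE tpure_mul mulr1 mul1r.
have YZ : Y *m Z = 1%:M.
  rewrite YE /Z -mulmxA [X in _ *m X]mulmxA -map_mxM antipode_coefmxr.
  by rewrite map_mx1 mul1mx -map_mxM antipode_coefmxr map_mx1.
have : X = Z by rewrite -[X]mulmx1 -YZ mulmxA XY mul1mx.
move/matrixP => /(_ r s); rewrite !mxE => ->; apply: eq_bigr => t _.
by rewrite !mxE tpure_mul mulr1 mul1r.
Qed.

End Coefficients.

(** * Averaging over the group *)

Section InvariantIntegral.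
Variables (k : closedFieldType) (A : comAlgType k) (G : affine_group A).
Variables (w : {scalar A}) (w_int : invariant_integral G w).
Variables (E : vectType k) (rho : linrep G E) (n : nat) (e : n.-tuple E).
Hypothesis e_basis : basis_of fullv e.
Variables (F : vectType k) (sigma : linrep G F) (m : nat) (f : m.-tuple F).
Hypothesis f_basis : basis_of fullv f.

Local Notation D := (coefmx rho e).
Local Notation D' := (coefmx sigma f).

(** The matrix of the average over [g] of [D'(g) B D(g)^-1], with [B] the matrix
unit of index [(s', r)]. *)
Definition averaged (r : 'I_n) (s' : 'I_m) : 'M[k]_(m, n) :=
  \matrix_(r', s) Tup2 G w (D r s) (D' r' s').

(** With [N] the average, the right-hand side is the [(r', s)] entry of
[D'(h) N D(h)^-1] at the generic point [h]. *)
Lemma invariance_coefmx (r s : 'I_n) (r' s' : 'I_m) :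
  (averaged r s' r' s)%:A =
  \sum_(t < n) \sum_(u < m)
    averaged r s' u t *: (antipode G (D t s) * D' r' u).
Proof.
have -> : (averaged r s' r' s)%:A =
    tlift (fun a b => w b *: a) (comul G (antipode G (D r s) * D' r' s')).
  by rewrite w_int.1 mxE.
have -> : comul G (antipode G (D r s) * D' r' s') =
    \sum_(p : 'I_n * 'I_m) (antipode G (D p.1 s) * D' r' p.2) *t
                            (antipode G (D r p.1) * D' p.2 s').
  rewrite rmorphM /= comul_antipode_coefmx // comul_coefmx //.
  rewrite big_distrlr pair_bigA; apply: eq_bigr => p _.
  exact: tpure_mul.
rewrite tlift_sum_pure; last exact: bilinear_scale_snd.
by rewrite pair_bigA; apply: eq_bigr => p _ /=; rewrite [averaged _ _ _ _]mxE.
Qed.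

(** The identity [N = D' N S(D)] of the previous lemma, multiplied on the right
by [D] so that [S(D) D = 1] simplifies. *)
Lemma averaged_intertwines (r : 'I_n) (s' : 'I_m) :
  map_mx (in_alg A) (averaged r s') *m D = D' *m map_mx (in_alg A) (averaged r s').
Proof.
set N := averaged r s'.
apply/matrixP => r' v; rewrite [LHS]mxE [RHS]mxE.
transitivity (\sum_(s < n) \sum_(t < n) \sum_(u < m)
    (N u t *: D' r' u) * (antipode G (D t s) * D s v)).
  apply: eq_bigr => s _; rewrite mxE [in_alg A _]invariance_coefmx mulr_suml.
  apply: eq_bigr => t _; rewrite mulr_suml; apply: eq_bigr => u _.
  by rewrite -!scalerAl [_ * D' _ _]mulrC mulrA.
rewrite exchange_big /=.
transitivity (\sum_(t < n) \sum_(u < m)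
    (N u t *: D' r' u) * (t == v)%:R).
  apply: eq_bigr => t _; rewrite exchange_big; apply: eq_bigr => u _ /=.
  rewrite -mulr_sumr; congr (_ * _).
  have /matrixP/(_ t v) := antipode_coefmxl rho e_basis; rewrite !mxE => <-.
  by apply: eq_bigr => s _; rewrite [in RHS]mxE.
rewrite (bigD1 v) //= [X in _ + X]big1 => [|t /negPf->]; last first.
  by rewrite big1 // => u _; rewrite mulr0.
rewrite addr0; apply: eq_bigr => u _.
by rewrite eqxx mulr1 [map_mx _ _ _ _]mxE mulr_algr.
Qed.

End InvariantIntegral.

(** * Schur's lemma *)

Section Schur.
Import VectorInternalTheory.
Local Open Scope classical_set_scope.
Local Open Scope ring_scope.
Variables (k : closedFieldType) (A : comAlgType k) (G : affine_group A).

Definition intertwiner (E F : lmodType k) (rho : linrep G E)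
    (sigma : linrep G F) (f : E -> F) : Prop :=
  forall x, coact sigma (f x) = tlift (fun y a => f y *t a) (coact rho x).

Lemma img_subrep (E F : lmodType k) (rho : linrep G E) (sigma : linrep G F)
    (f : {linear E -> F}) :
  intertwiner rho sigma f -> subrep sigma (range f).
Proof.
move=> fi; split.
  split=> [|a _ _ [x _ <-] [y _ <-]]; first by exists 0; rewrite ?linear0.
  by exists (a *: x + y); rewrite ?linearP.
move=> _ [x _ <-].
exists [seq (f p.1, p.2) | p <- repr (coact rho x)]; split.
  by move=> _ /mapP[p _ ->]; exists p.1.
by rewrite fi big_map.
Qed.

(** A subrepresentation is asked to satisfy [coact x \in P (x) A] in the form of
an explicit sum of pure tensors with first factors in [P]. Such a sum comes from
applying the projection [1 - h f] onto the kernel, [h] being a linear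
pseudo-inverse of [f], to the first factors of [coact x]: the correction
[(h f (x) 1) (coact x)] is [(h (x) 1) (coact (f x))], which is zero. *)
Lemma ker_subrep (E F : vectType k) (rho : linrep G E) (sigma : linrep G F)
    (f : {linear E -> F}) :
  intertwiner rho sigma f -> subrep rho [set x | f x = 0].
Proof.
move=> fi; split.
  split=> [|a x y /= fx fy]; first exact: linear0.
  by rewrite linearP fx fy scaler0 addr0.
move=> x /= fx.
pose h := ((linfun f)^-1)%VF.
have fh y : f (h (f y)) = f y.
  have := @limg_lfunVK _ _ _ (linfun f) (f y); rewrite lfunE; apply.
  by rewrite -[f y](lfunE f) memv_img ?memvf.
exists [seq (p.1 - h (f p.1), p.2) | p <- repr (coact rho x)]; split.
  by move=> _ /mapP[p _ ->] /=; rewrite linearB fh subrr.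
rewrite big_map {1}[coact rho x]tens_sum /bsum.
under [RHS]eq_bigr => p _ do rewrite linearBl.
rewrite sumrB /=.
suff -> : \sum_(p <- repr (coact rho x)) h (f p.1) *t p.2 = 0 :> tens E A.
  by rewrite subr0.
rewrite -[LHS]/(tlift (fun y a => h (f y) *t a) (coact rho x)).
have lh : linear (fun y => h y) by exact: linearP.
have := congr1 (tlift (fun y a => h y *t a)) (fi x).
have bh := bilinear_tpure_fst A lh.
rewrite fx linear0 (tlift_zero bh) (linear_tlift _ _ (tlift_linear bh)) => /esym.
by move=> <-; apply: eq_tlift => y a; rewrite tlift_pure.
Qed.

Lemma schur_bijective (E F : vectType k) (rho : linrep G E) (sigma : linrep G F)
    (f : {linear E -> F}) :
  irreducible rho -> irreducible sigma -> intertwiner rho sigma f ->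
  (exists x, f x != 0) -> bijective f.
Proof.
move=> [_ _ irrE] [_ _ irrF] fi [x fx].
have f_inj : injective f.
  apply: raddf_inj => y fy.
  have [ker0|kerT] := irrE _ (ker_subrep fi) (fun _ _ => Logic.I).
    by have : [set y | f y = 0] y by []; rewrite ker0.
  have : [set y | f y = 0] x by rewrite kerT.
  by move/eqP; rewrite (negPf fx).
have f_surj y : range f y.
  have [img0|->//] := irrF _ (img_subrep fi) (fun _ _ => Logic.I).
  have : range f (f x) by exists x.
  by rewrite img0 => /eqP; rewrite (negPf fx).
have gK : cancel (fun y => s2val (cid2 (f_surj y))) f by move=> y; case: cid2.
exact: Bijective (inj_can_sym gK f_inj) gK.
Qed.

(** The coordinate matrix of [f] has a characteristic polynomial of size at
least two, which has a root as [k] is algebraically closed. *)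
Lemma eigenvector_exists (E : vectType k) (f : {linear E -> E}) :
  (exists x : E, x != 0) -> exists a x, x != 0 /\ f x = a *: x.
Proof.
move=> [x0 x0nz]; pose M := lin1_mx (v2r \o f \o r2v).
have dimE : dim E != 0%N.
  apply: contra_neq x0nz => d0; apply: (can_inj v2rK).
  by apply/rowP => -[j jlt]; exfalso; move: jlt; rewrite d0.
have [|a] := @closed_rootP k (char_poly M) _.
  by rewrite size_char_poly.
rewrite -eigenvalue_root_char => /eigenvalueP[v vM vnz].
exists a, (r2v v); split.
  by apply: contraNneq vnz => v0; rewrite -[v]r2vK v0 linear0.
have -> : f (r2v v) = r2v (v *m M) by rewrite mul_rV_lin1 /= v2rK.
by rewrite vM linearZ.
Qed.

(** For an eigenvalue [a], the intertwiner [f - a] kills a nonzero vector, so it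
is not bijective and must vanish. *)
Lemma schur_scalar (E : vectType k) (rho : linrep G E) (f : {linear E -> E}) :
  irreducible rho -> intertwiner rho rho f -> exists a, forall x, f x = a *: x.
Proof.
move=> irr fi.
have [x0 x0nz] : exists x : E, x != 0.
  have [_ E_neq0 _] := irr; apply: contra_notP E_neq0 => E0.
  apply/seteqP; split=> [x _ /=|//].
  by apply: contra_notP E0 => /eqP xnz; exists x.
have [a [v [vnz fv]]] := eigenvector_exists f (ex_intro _ x0 x0nz).
exists a => x; apply/eqP; rewrite -subr_eq0; apply: contraNT vnz => gx.
pose g : {linear E -> E} := f \- (a \*: idfun).
have gi : intertwiner rho rho g.
  move=> y; rewrite /= linearB linearZ_LR fi.
  rewrite -[in X in _ - X](tlift_tpure (coact rho y)).
  rewrite /tlift /bsum scaler_sumr -sumrB; apply: eq_bigr => p _.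
  by rewrite linearBl linearZl_LR.
have /bij_inj g_inj := schur_bijective irr irr gi (ex_intro _ x gx).
by apply/eqP/g_inj; rewrite linear0 /= fv subrr.
Qed.

End Schur.

(** * Orthogonality of matrix coefficients *)

Section Orthogonality.
Variables (k : closedFieldType) (A : comAlgType k) (G : affine_group A).
Variables (w : {scalar A}) (w_int : invariant_integral G w).

(** The two coactions being linear, it is enough to compare them on the basis,
where they are the columns of [D' N] and [N D]. *)
Lemma intertwiner_of_mx (E F : vectType k) (rho : linrep G E)
    (sigma : linrep G F) (n m : nat) (e : n.-tuple E) (f : m.-tuple F)
    (N : 'M[k]_(m, n)) :
  basis_of fullv e -> basis_of fullv f ->
  map_mx (in_alg A) N *m coefmx rho e = coefmx sigma f *m map_mx (in_alg A) N ->
  exists2 phi : {linear E -> F}, intertwiner rho sigma phi &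
    forall (r' : 'I_m) (s : 'I_n), coord f r' (phi e`_s) = N r' s.
Proof.
move=> e_basis f_basis ND.
pose phi0 x : F := \sum_(s < n) coord e s x *: \sum_(r' < m) N r' s *: f`_r'.
have lphi : linear phi0.
  move=> a x y; rewrite /phi0 scaler_sumr -big_split; apply: eq_bigr => s _ /=.
  by rewrite linearP scalerDl scalerA.
have [phi phiE] : exists phi : {linear E -> F}, phi =1 phi0.
  pose phi : {linear E -> F} :=
    HB.pack phi0 (GRing.isLinear.Build _ _ _ _ phi0 lphi).
  by exists phi.
have phi_e (s : 'I_n) : phi e`_s = \sum_(r' < m) N r' s *: f`_r'.
  rewrite phiE /phi0 (bigD1 s) //= coord_free ?(basis_free e_basis) // eqxx scale1r.
  rewrite [X in _ + X]big1 ?addr0 // => t ts.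
  by rewrite coord_free ?(basis_free e_basis) // eq_sym (negPf ts) scale0r.
exists phi; last first.
  by move=> r' s; rewrite phi_e coord_sum_free ?(basis_free f_basis).
have bphi : is_bilinear (fun y (a : A) => phi y *t a).
  by apply: bilinear_tpure_fst; exact: linearP.
have base (s : 'I_n) : coact sigma (phi e`_s) =
    tlift (fun y a => phi y *t a) (coact rho e`_s).
  rewrite tlift_coact_basis // phi_e linear_sum.
  transitivity (\sum_(u < m)
      f`_u *t (coefmx sigma f *m map_mx (in_alg A) N) u s).
    transitivity (\sum_(r' < m) \sum_(u < m)
        f`_u *t (N r' s *: coefmx sigma f u r')).
      apply: eq_bigr => r' _; rewrite linearZ_LR coact_basis // scaler_sumr.
      by apply: eq_bigr => u _; rewrite linearZr_LR.
    rewrite exchange_big; apply: eq_bigr => u _ /=.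
    rewrite mxE linear_sumr; apply: eq_bigr => r' _.
    by rewrite [map_mx _ _ _ _]mxE mulr_algr.
  rewrite -ND.
  transitivity (\sum_(u < m) \sum_(t < n) f`_u *t (N u t *: coefmx rho e t s)).
    apply: eq_bigr => u _; rewrite mxE linear_sumr; apply: eq_bigr => t _.
    by rewrite [map_mx _ _ _ _]mxE mulr_algl.
  rewrite exchange_big; apply: eq_bigr => t _.
  rewrite phi_e linear_sumlz; apply: eq_bigr => u _.
  by rewrite linearZl_LR linearZr_LR.
move=> x; rewrite {1 2}(basis_sum e_basis x) !linear_sum.
rewrite (big_morph _ (fun y z => tlift_add y z bphi) (tlift_zero bphi)).
apply: eq_bigr => s _.
by rewrite !linearZ_LR base (tlift_scale _ _ bphi).
Qed.

Lemma orthogonal_noniso (E F : vectType k) (rho : linrep G E)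
    (sigma : linrep G F) (n m : nat) (e : n.-tuple E) (f : m.-tuple F) :
  basis_of fullv e -> basis_of fullv f ->
  irreducible rho -> irreducible sigma -> ~ rep_iso rho sigma ->
  forall r s r' s',
    Tup2 G w (mxcoef rho e r s) (mxcoef sigma f r' s') = 0.
Proof.
move=> e_basis f_basis irrE irrF niso r s r' s'.
have [phi phi_i phiE] := intertwiner_of_mx e_basis f_basis
  (averaged_intertwines w_int rho e_basis sigma f_basis r s').
have phi0 x : phi x = 0.
  apply/eqP/negPn/negP => phix; apply: niso.
  by exists phi => //; apply: (schur_bijective irrE irrF phi_i); exists x.
by have := phiE r' s; rewrite phi0 linear0 !mxE.
Qed.

Lemma orthogonal_iso (E : vectType k) (rho : linrep G E) (n : nat)
    (e : n.-tuple E) :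
  basis_of fullv e -> irreducible rho ->
  forall r s r' s' : 'I_n,
    Tup2 G w (mxcoef rho e r s) (mxcoef rho e r' s') =
    if (r == s') && (s == r') then n%:R^-1 else 0.
Proof.
move=> e_basis irr r s r' s'.
have avgE (q : 'I_n) : exists2 c, n%:R * c = (r == q)%:R &
    forall t u : 'I_n,
      Tup2 G w (mxcoef rho e r t) (mxcoef rho e u q) = (t == u)%:R * c.
  have [phi phi_i phiE] := intertwiner_of_mx e_basis e_basis
    (averaged_intertwines w_int rho e_basis rho e_basis r q).
  have [c phic] := schur_scalar irr phi_i.
  have cE t u : Tup2 G w (mxcoef rho e r t) (mxcoef rho e u q) = (t == u)%:R * c.
    have := phiE u t.
    rewrite phic linearZ /= coord_free ?(basis_free e_basis) // !mxE => <-.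
    by rewrite mulrC eq_sym.
  exists c => //.
  (* Each of the [n] diagonal terms [t = u] integrates to [c]. *)
  transitivity (w (\sum_(t < n) antipode G (coefmx rho e r t) * coefmx rho e t q)).
    rewrite linear_sum (eq_bigr (fun=> c)) ?sumr_const ?card_ord ?mulr_natl //.
    by move=> t _; have := cE t t; rewrite eqxx mul1r /Tup2 !mxE.
  have /matrixP/(_ r q) := antipode_coefmxl rho e_basis.
  rewrite mxE [RHS]mxE; under eq_bigr do rewrite [map_mx _ _ _ _]mxE.
  by move=> ->; case: (r == q); rewrite ?linear0 // w_int.2.
(* At [q = r] the relation reads [n c = 1]. *)
have n_neq0 : n%:R != 0 :> k.
  have [c nc _] := avgE r; apply/eqP => n0; move/eqP: nc.
  by rewrite n0 mul0r eqxx eq_sym oner_eq0.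
have [c nc ->] := avgE s'.
have -> : c = (r == s')%:R / n%:R by rewrite -nc mulrAC mulfV ?mul1r.
by case: (r == s'); case: (s == r'); rewrite /= ?mul0r ?mulr0 ?mul1r.
Qed.

End Orthogonality.

(** * The trace form on matrix units *)

(** The matrices with a single nonzero column form [n] invariant subspaces, on
each of which left multiplication acts as [B]: in coordinates, the diagonal
entry at the matrix unit of index [(i, j)] is [B i i]. *)
Lemma mxtrace_lin_mulmx (R : comPzSemiRingType) (n : nat) (B : 'M[R]_n) :
  \tr (lin_mulmx B : 'M_(n * n)) = n%:R * \tr B.
Proof.
rewrite /mxtrace (reindex _ (curry_mxvec_bij n n)) /=.
transitivity (\sum_(p : 'I_n * 'I_n) B p.1 p.1).
  apply: eq_bigr => -[i j] _ /=.
  have := congr1 (fun M : 'rV_(n * n) => M 0 (mxvec_index i j))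
    (mul_vec_lin (mulmx B) (delta_mx i j)).
  rewrite /lin_mulmx mxvec_delta -rowE mxE => ->.
  rewrite mxvecE mxE (bigD1 i) //= mxE !eqxx mulr1 big1 ?addr0 // => t ti.
  by rewrite mxE (negPf ti) mulr0.
rewrite -(pair_bigA _ (fun i j => B i i)) /= mulr_sumr.
by apply: eq_bigr => i _; rewrite sumr_const card_ord mulr_natl.
Qed.

Section DirectSum.
Variables (k : closedFieldType) (I : choiceType) (n : I -> nat).

Lemma munit_same (i : I) (r s : 'I_(n i)) : munit_fun k r s i = delta_mx r s.
Proof. by rewrite /munit_fun dfwith_in. Qed.

Lemma munit_other (i j : I) (r s : 'I_(n i)) : i != j -> munit_fun k r s j = 0.
Proof. by move=> ij; rewrite /munit_fun dfwith_out. Qed.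

(** When the two blocks agree the value is [n * n^-1 * n^-1]. This equals [n^-1]
even if [n] is zero in [k], the inverse of zero being zero. *)
Lemma Tdown2_munit (i i' : I) (r s : 'I_(n i)) (r' s' : 'I_(n i')) :
  Tdown2 (mxsum_scale (n i)%:R^-1 (munit k r s))
         (mxsum_scale (n i')%:R^-1 (munit k r' s')) =
  if [&& i == i', (r : nat) == s' & (s : nat) == r']
  then (n i)%:R^-1 else 0.
Proof.
rewrite /Tdown2 /mxsum_tr /=.
rewrite -(fsbig_widen [set i]%classic) //=; last first.
  move=> j [_ /= ji]; rewrite munit_other ?scaler0 ?mul0mx.
    by rewrite mxtrace_lin_mulmx mxtrace0 mulr0.
  by apply/eqP => ij; apply: ji.
rewrite fsbig_set1 munit_same mxtrace_lin_mulmx.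
case: (eqVneq i i') => [ii|ii'] /=; last first.
  by rewrite [munit_fun k r' s' i]munit_other 1?eq_sym // scaler0 mulmx0 mxtrace0 mulr0.
subst i'; rewrite munit_same -scalemxAl -scalemxAr scalerA mxtraceZ.
rewrite mul_delta_mx_cond raddfMn /=.
have -> : \tr (delta_mx r s') = (r == s')%:R :> k.
  rewrite /mxtrace (bigD1 r) //= mxE eqxx /= big1 ?addr0 // => t tr.
  by rewrite mxE (negPf tr).
have [->|n_neq0] := eqVneq ((n i)%:R : k) 0; first by rewrite mul0r invr0 if_same.
rewrite !mulrA mulfV // mul1r.
rewrite -!val_eqE /=.
by case: eqP => _; case: eqP => _; rewrite /= ?mul0rn ?mulr0 ?mulr1.
Qed.

End DirectSum.

Theorem mainTheorem4
  (k : closedFieldType) (A : comAlgType k) (G : affine_group A)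
  (Gss : semisimple G)
  (I : choiceType) (E : I -> vectType k) (rho : forall i, linrep G (E i))
  (Ghat : irreps rho)
  (n : I -> nat) (n_dim : forall i, n i = \dim {:E i})
  (e : forall i, (n i).-tuple (E i)) (e_basis : forall i, basis_of fullv (e i))
  (wG : {scalar A}) (wG_int : invariant_integral G wG)
  (i i' : I) (r s : 'I_(n i)) (r' s' : 'I_(n i')) :
  let delta (j : I) (p q : 'I_(n j)) : A := mxcoef (rho j) (e j) p q in
  let w (j : I) (p q : 'I_(n j)) : mxsum k n := munit k p q in
  let T2ww := Tdown2 (mxsum_scale (n i)%:R^-1 (w i r s))
                     (mxsum_scale (n i')%:R^-1 (w i' r' s')) in
  Tup2 G wG (delta i r s) (delta i' r' s') = T2ww /\
  T2ww = if [&& i == i', (r : nat) == s' & (s : nat) == r']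
         then (n i)%:R^-1 else 0.
Proof.
move=> delta w T2ww; split; last exact: Tdown2_munit.
rewrite /T2ww Tdown2_munit /delta.
case: (eqVneq i i') => [ii|ii'] /=.
  by subst i'; exact: (orthogonal_iso wG_int (e_basis i) (irreps_irr Ghat i)).
apply: (orthogonal_noniso wG_int (e_basis i) (e_basis i')).
- exact: irreps_irr.
- exact: irreps_irr.
by move=> /(irreps_inj Ghat) /eqP; rewrite (negPf ii').
Qed.
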